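(* Define polynomials $F_n(z)$ by \[ \sum_{n\ge0}F_n(z)q^n=\prod_{n=1}^\infty\frac{(1+zq^n)^n}{(1-q^n)^{\lceil n/2\rceil}(1-z^2q^n)^{\lfloor n/2\rfloor}}. \] Then $[z^{k+1}]F_{n+1}(z)=[z^k]F_n(z)$ for all $n\ge0$ and $k\ge 2n/3$.
   Context: $[z^k]$ denotes coefficient extraction. *)

(* Defs.v *)
From HB Require Import structures.
From mathcomp Require Import all_boot all_order all_algebra.
From mathcomp Require Import boolp.

Set Implicit Arguments.
Unset Strict Implicit.
Unset Printing Implicit Defensive.

Import GRing.Theory.
Local Open Scope ring_scope.

(* Formal power series in one variable over R; [fps_coef f n] is the
   coefficient of the n-th power of the variable. *)
Record fps (R : Type) := Fps { fps_coef : nat -> R }.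

HB.instance Definition _ (R : Type) := gen_eqMixin (fps R).
HB.instance Definition _ (R : Type) := gen_choiceMixin (fps R).

Lemma fpsP (R : Type) (f g : fps R) : fps_coef f =1 fps_coef g -> f = g.
Proof. by case: f g => [f] [g] /= /funext ->. Qed.

Definition fps_zero (R : comUnitRingType) : fps R := Fps (fun _ => 0).
Definition fps_opp (R : comUnitRingType) (f : fps R) : fps R :=
  Fps (fun n => - fps_coef f n).
Definition fps_add (R : comUnitRingType) (f g : fps R) : fps R :=
  Fps (fun n => fps_coef f n + fps_coef g n).

Fact fps_addA (R : comUnitRingType) : associative (@fps_add R).
Proof. by move=> f g h; apply: fpsP => n /=; rewrite addrA. Qed.
Fact fps_addC (R : comUnitRingType) : commutative (@fps_add R).
Proof. by move=> f g; apply: fpsP => n /=; rewrite addrC. Qed.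
Fact fps_add0 (R : comUnitRingType) : left_id (fps_zero R) (@fps_add R).
Proof. by move=> f; apply: fpsP => n /=; rewrite add0r. Qed.
Fact fps_addN (R : comUnitRingType) :
  left_inverse (fps_zero R) (@fps_opp R) (@fps_add R).
Proof. by move=> f; apply: fpsP => n /=; rewrite addNr. Qed.

HB.instance Definition _ (R : comUnitRingType) :=
  GRing.isZmodule.Build (fps R)
    (@fps_addA R) (@fps_addC R) (@fps_add0 R) (@fps_addN R).

Definition fpsC (R : comUnitRingType) (c : R) : fps R :=
  Fps (fun n => if n is 0%N then c else 0).
Definition fpsX (R : comUnitRingType) : fps R := Fps (fun n => (n == 1%N)%:R).
Definition fps_mul (R : comUnitRingType) (f g : fps R) : fps R :=
  Fps (fun n => \sum_(i < n.+1) fps_coef f i * fps_coef g (n - i)).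

Definition fps_trunc (R : comUnitRingType) (n : nat) (f : fps R) : {poly R} :=
  \poly_(i < n.+1) fps_coef f i.

Lemma coef_fps_trunc (R : comUnitRingType) (f : fps R) (n i : nat) :
  (i <= n)%N -> (fps_trunc n f)`_i = fps_coef f i.
Proof. by move=> le_in; rewrite coef_poly ltnS le_in. Qed.

Lemma coef_fps_mul_trunc (R : comUnitRingType) (f g : fps R) (n i : nat) :
  (i <= n)%N ->
  fps_coef (fps_mul f g) i = (fps_trunc n f * fps_trunc n g)`_i.
Proof.
move=> le_in; rewrite coefM; apply: eq_bigr => j _.
rewrite !coef_fps_trunc //; first exact: leq_trans (leq_subr _ _) le_in.
by apply: leq_trans le_in; rewrite -ltnS.
Qed.

Fact fps_mulC (R : comUnitRingType) : commutative (@fps_mul R).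
Proof.
by move=> f g; apply: fpsP => n; rewrite !(coef_fps_mul_trunc _ _ (leqnn n)) mulrC.
Qed.
Fact fps_mulA (R : comUnitRingType) : associative (@fps_mul R).
Proof.
move=> f g h; apply: fpsP => n.
pose T (u : fps R) := fps_trunc n u; transitivity (T f * T g * T h)`_n.
  rewrite -mulrA coefM /=; apply: eq_bigr => i _.
  have le_in : (i <= n)%N by rewrite -ltnS.
  by rewrite -(coef_fps_mul_trunc _ _ (leq_subr i n)) coef_fps_trunc.
rewrite coefM /=; apply: eq_bigr => i _.
have le_in : (i <= n)%N by rewrite -ltnS.
by rewrite -(coef_fps_mul_trunc _ _ le_in) coef_fps_trunc ?leq_subr.
Qed.
Fact fps_mul1 (R : comUnitRingType) : left_id (fpsC (1 : R)) (@fps_mul R).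
Proof.
move=> f; apply: fpsP => n /=.
by rewrite big_ord_recl /= mul1r subn0 big1 ?addr0 // => i _; rewrite mul0r.
Qed.
Fact fps_mulDl (R : comUnitRingType) : left_distributive (@fps_mul R) +%R.
Proof.
move=> f g h; apply: fpsP => n /=; rewrite -big_split /=.
by apply: eq_bigr => i _; rewrite mulrDl.
Qed.
Fact fps_1neq0 (R : comUnitRingType) : fpsC (1 : R) != 0.
Proof.
apply/eqP => /(congr1 (fun f : fps R => fps_coef f 0)) /= /eqP.
by rewrite oner_eq0.
Qed.

HB.instance Definition _ (R : comUnitRingType) :=
  GRing.Zmodule_isComNzRing.Build (fps R) (@fps_mulA R) (@fps_mulC R)
    (@fps_mul1 R) (@fps_mulDl R) (@fps_1neq0 R).

Definition fps_unit (R : comUnitRingType) : pred (fps R) :=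
  fun f => fps_coef f 0 \is a GRing.unit.

(* [fps_inv_seq f n] lists the coefficients of 1/f of degree at most n. *)
Fixpoint fps_inv_seq (R : comUnitRingType) (f : fps R) (n : nat) : seq R :=
  if n is m.+1 then
    let s := fps_inv_seq f m in
    rcons s (- (fps_coef f 0)^-1 *
               \sum_(i < m.+1) fps_coef f i.+1 * s`_(m - i))
  else [:: (fps_coef f 0)^-1].

(* As everywhere in the library, inversion is the identity on non-units. *)
Definition fps_inv (R : comUnitRingType) (f : fps R) : fps R :=
  if fps_unit f then Fps (fun n => (fps_inv_seq f n)`_n) else f.

Lemma size_fps_inv_seq (R : comUnitRingType) (f : fps R) (n : nat) :
  size (fps_inv_seq f n) = n.+1.
Proof. by elim: n => //= n IHn; rewrite size_rcons IHn. Qed.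

Lemma nth_fps_inv_seq (R : comUnitRingType) (f : fps R) (n i : nat) :
  (i <= n)%N -> (fps_inv_seq f n)`_i = (fps_inv_seq f i)`_i.
Proof.
elim: n => [|n IHn]; first by rewrite leqn0 => /eqP ->.
rewrite leq_eqVlt => /predU1P [-> // | lt_in] /=.
by rewrite nth_rcons size_fps_inv_seq lt_in IHn.
Qed.

Fact fps_mulVf (R : comUnitRingType) :
  {in @fps_unit R, left_inverse 1 (@fps_inv R) *%R}.
Proof.
move=> f; rewrite -[_ \in _]/(fps_unit f) => Uf; rewrite mulrC; apply: fpsP => -[|n] /=.
  by rewrite big_ord1 /fps_inv Uf /= divrr.
rewrite big_ord_recl /fps_inv Uf subn0 /=.
rewrite nth_rcons size_fps_inv_seq ltnn eqxx mulrA mulrN divrr // mulN1r.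
apply/eqP; rewrite addrC subr_eq0; apply/eqP/eq_bigr => i _.
by rewrite /bump /= add1n subSS (nth_fps_inv_seq _ (leq_subr i n)).
Qed.
Fact fps_unitP (R : comUnitRingType) (f g : fps R) :
  g * f = 1 -> fps_unit f.
Proof.
move=> /(congr1 (fun h : fps R => fps_coef h 0)) /=.
by rewrite big_ord1 => gf1; apply/unitrPr; exists (fps_coef g 0); rewrite mulrC.
Qed.
Fact fps_inv_out (R : comUnitRingType) :
  {in [predC @fps_unit R], @fps_inv R =1 id}.
Proof. by move=> f; rewrite -[_ \in _]/(~~ fps_unit f) /fps_inv => /negPf ->. Qed.

HB.instance Definition _ (R : comUnitRingType) :=
  GRing.ComNzRing_hasMulInverse.Build (fps R)
    (@fps_mulVf R) (@fps_unitP R) (@fps_inv_out R).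

(* [fps_infprod u P]: the infinite product u_1 u_2 u_3 ... converges to P
   coefficientwise, each coefficient of the partial products being eventually
   constant. *)
Definition fps_infprod (R : comUnitRingType) (u : nat -> fps R) (P : fps R) :=
  forall n, exists N0, forall N, (N0 <= N)%N ->
    fps_coef (\prod_(1 <= m < N.+1) u m) n = fps_coef P n.

(* The variable z is ['X : {poly int}] and q is [fpsX {poly int}]. *)
Definition gf_num (n : nat) : fps {poly int} :=
  (1 + fpsC 'X * fpsX _ ^+ n) ^+ n.
Definition gf_den (n : nat) : fps {poly int} :=
  (1 - fpsX _ ^+ n) ^+ uphalf n * (1 - fpsC ('X ^+ 2) * fpsX _ ^+ n) ^+ n./2.
Definition gf_factor (n : nat) : fps {poly int} := gf_num n / gf_den n.

Lemma fps_infprod_uniq (R : comUnitRingType) (u : nat -> fps R)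
    (P Q : fps R) : fps_infprod u P -> fps_infprod u Q -> P = Q.
Proof.
move=> uP uQ; apply: fpsP => n.
have [M hM] := uP n; have [N hN] := uQ n.
by rewrite -(hM (maxn M N)) ?leq_maxl // hN ?leq_maxr.
Qed.

Definition fps_eqm (R : comUnitRingType) (n : nat) (f g : fps R) :=
  forall i, (i < n)%N -> fps_coef f i = fps_coef g i.

Lemma fps_eqmM (R : comUnitRingType) (n : nat) (f f' g g' : fps R) :
  fps_eqm n f f' -> fps_eqm n g g' -> fps_eqm n (f * g) (f' * g').
Proof.
move=> ff' gg' i lt_in /=; apply: eq_bigr => j _.
rewrite ff' ?gg' //; first exact: leq_ltn_trans (leq_subr _ _) lt_in.
by apply: leq_ltn_trans lt_in; rewrite -ltnS.
Qed.

Lemma fps_eqm1X (R : comUnitRingType) (n k : nat) (f : fps R) :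
  fps_eqm n f 1 -> fps_eqm n (f ^+ k) 1.
Proof.
move=> f1; elim: k => [|k IHk]; first by rewrite expr0.
by rewrite exprS -[X in fps_eqm _ _ X]mulr1; apply: fps_eqmM.
Qed.

Lemma fps_coefXn (R : comUnitRingType) (n i : nat) :
  fps_coef (fpsX R ^+ n) i = (i == n)%:R.
Proof.
elim: n i => [|n IHn] i; first by rewrite expr0; case: i.
rewrite exprS; case: i => [|i] /=; first by rewrite big_ord1 mul0r.
rewrite big_ord_recl mul0r add0r big_ord_recl mul1r subSS subn0 IHn eqSS.
by rewrite big1 ?addr0 // => j _; rewrite /= mul0r.
Qed.

Lemma fps_coefD (R : comUnitRingType) (f g : fps R) (i : nat) :
  fps_coef (f + g) i = fps_coef f i + fps_coef g i.
Proof. by []. Qed.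

Lemma fps_coefB (R : comUnitRingType) (f g : fps R) (i : nat) :
  fps_coef (f - g) i = fps_coef f i - fps_coef g i.
Proof. by []. Qed.

Lemma fps_coefCM (R : comUnitRingType) (c : R) (f : fps R) (i : nat) :
  fps_coef (fpsC c * f) i = c * fps_coef f i.
Proof.
by rewrite /= big_ord_recl /= subn0 big1 ?addr0 // => j _; rewrite mul0r.
Qed.

Lemma gf_num_eqm1 (n : nat) : fps_eqm n (gf_num n) 1.
Proof.
apply: fps_eqm1X => i lt_in.
by rewrite fps_coefD fps_coefCM fps_coefXn ltn_eqF // mulr0 addr0.
Qed.

Lemma gf_den_eqm1 (n : nat) : fps_eqm n (gf_den n) 1.
Proof.
rewrite -[X in fps_eqm _ _ X]mulr1.
apply: fps_eqmM; apply: fps_eqm1X => i lt_in; rewrite fps_coefB.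
  by rewrite fps_coefXn ltn_eqF // subr0.
by rewrite fps_coefCM fps_coefXn ltn_eqF // mulr0 subr0.
Qed.

Lemma gf_den_unit (n : nat) : (0 < n)%N -> gf_den n \is a GRing.unit.
Proof.
by move=> n_gt0; rewrite unfold_in /= /fps_unit (gf_den_eqm1 n_gt0) unitr1.
Qed.

Lemma gf_factor_eqm1 (n : nat) : fps_eqm n (gf_factor n) 1.
Proof.
case: n => // n i lt_in.
have Ud := gf_den_unit (ltn0Sn n).
rewrite -(divrr Ud); apply: fps_eqmM lt_in => // j lt_jn.
by rewrite gf_num_eqm1 // gf_den_eqm1.
Qed.

Lemma gf_infprod_exists :
  exists F : nat -> {poly int}, fps_infprod gf_factor (Fps F).
Proof.
exists (fun n => fps_coef (\prod_(1 <= m < n.+1) gf_factor m) n) => n.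
exists n => N /subnKC <-; elim: (N - n)%N => [|d IHd]; first by rewrite addn0.
rewrite addnS big_nat_recr //= -[RHS]IHd.
set P := \prod_(_ <= _ < _) _; transitivity (fps_coef (P * 1) n).
  have PP : fps_eqm (n + d).+1 P P by [].
  by apply: fps_eqmM PP (@gf_factor_eqm1 _) _ _; rewrite ltnS leq_addr.
by rewrite mulr1.
Qed.

(* Main.v *)
Require Import Defs.
From mathcomp Require Import all_boot all_order all_algebra.
From mathcomp Require Import zify ring.
Import GRing.Theory.
Local Open Scope ring_scope.

(** Give the monomial z^k q^n the weight 3k - 2n.  The claim says that
    (1 - zq) times the product has no monomial of positive weight.  The only
    factors containing such monomials are 1 + zq and 1 - z^2 q^2, and
    (1 - zq) (1 + zq) / (1 - z^2 q^2) = 1. *)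

Definition nonpos_weight (f : fps {poly int}) :=
  forall n k, (2 * n < 3 * k)%N -> (fps_coef f n)`_k = 0.

Lemma nonpos_weightD f g :
  nonpos_weight f -> nonpos_weight g -> nonpos_weight (f + g).
Proof. by move=> wf wg n k lt_nk; rewrite fps_coefD coefD wf // wg // addr0. Qed.

Lemma nonpos_weightN f : nonpos_weight f -> nonpos_weight (- f).
Proof. by move=> wf n k lt_nk; rewrite /= coefN wf // oppr0. Qed.

Lemma nonpos_weight1 : nonpos_weight 1.
Proof.
by case=> [|n] k lt_nk; rewrite /= ?coef0 // coef1; case: k lt_nk.
Qed.

(** Weights add under multiplication, so in each term of the convolution at least one of the two
    coefficients has positive weight. *)
Lemma coef_mul_nonpos_weight (p r : {poly int}) (a b k : nat) :
    (forall i, (2 * a < 3 * i)%N -> p`_i = 0) ->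
    (forall i, (2 * b < 3 * i)%N -> r`_i = 0) ->
  (2 * (a + b) < 3 * k)%N -> (p * r)`_k = 0.
Proof.
move=> wp wr lt_abk; rewrite coefM big1 // => i _.
have [lt_ai | le_ia] := ltnP (2 * a) (3 * i); first by rewrite wp // mul0r.
by rewrite wr ?mulr0 //; lia.
Qed.

Lemma nonpos_weightM f g :
  nonpos_weight f -> nonpos_weight g -> nonpos_weight (f * g).
Proof.
move=> wf wg n k lt_nk; rewrite /= coef_sum big1 // => i _.
apply: (@coef_mul_nonpos_weight _ _ i (n - i)); [exact: wf | exact: wg |].
by rewrite subnKC // -ltnS.
Qed.

Lemma nonpos_weightX f m : nonpos_weight f -> nonpos_weight (f ^+ m).
Proof.
move=> wf; elim: m => [|m IHm]; first exact: nonpos_weight1.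
by rewrite exprS; apply: nonpos_weightM.
Qed.

Lemma nonpos_weight_prod (I : Type) (r : seq I) (P : pred I)
    (u : I -> fps {poly int}) :
    (forall i, P i -> nonpos_weight (u i)) ->
  nonpos_weight (\prod_(i <- r | P i) u i).
Proof. exact: (big_ind _ nonpos_weight1 nonpos_weightM). Qed.

(** Strong induction on the [q]-degree: since [f] has constant term 1, comparing coefficients in
    [f^-1 * f = 1] expresses each coefficient of [f^-1] through earlier ones. *)
Lemma nonpos_weightV f :
  fps_coef f 0 = 1 -> nonpos_weight f -> nonpos_weight f^-1.
Proof.
move=> f0 wf n; have Uf : f \is a GRing.unit.
  by rewrite unfold_in /= /fps_unit f0 unitr1.
elim/ltn_ind: n => n IHn k lt_nk.
have /(congr1 (fun p : {poly int} => p`_k)) := congr1 (fun g => fps_coef g n) (mulVr Uf).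
(* The last term of the convolution is coefficient [n] of [f^-1] itself; the others fall under the
   induction hypothesis. *)
rewrite (nonpos_weight1 _ _ lt_nk) /= big_ord_recr /= subnn f0 mulr1 coefD coef_sum.
rewrite big1 ?add0r // => i _; have lt_in := ltn_ord i.
apply: (@coef_mul_nonpos_weight _ _ i (n - i)).
- exact: IHn.
- exact: wf.
- by rewrite subnKC // ltnW.
Qed.

Lemma nonpos_weight_monomial (j m : nat) :
  (3 * j <= 2 * m)%N -> nonpos_weight (fpsC 'X^j * fpsX _ ^+ m).
Proof.
move=> le_jm n k lt_nk; rewrite fps_coefCM fps_coefXn.
case: eqP => [n_m|_]; last by rewrite mulr0 coef0.
by rewrite mulr1 coefXn; case: eqP => // k_j; lia.
Qed.

Lemma nonpos_weight_q (m : nat) : nonpos_weight (fpsX {poly int} ^+ m).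
Proof.
have := nonpos_weight_monomial 0 m (leq0n _).
by rewrite expr0 -[fpsC 1]/(1 : fps {poly int}) mul1r.
Qed.

(** The monomial $zq^m$ has weight $3-2m$, positive for $m=1$. *)
Lemma nonpos_weight_num (m : nat) : (1 < m)%N -> nonpos_weight (gf_num m).
Proof.
move=> m_gt1; apply/nonpos_weightX/nonpos_weightD; first exact: nonpos_weight1.
by rewrite -['X]expr1; apply: nonpos_weight_monomial; lia.
Qed.

Lemma nonpos_weight_one_sub_q (m : nat) :
  nonpos_weight (1 - fpsX {poly int} ^+ m).
Proof.
apply: nonpos_weightD; first exact: nonpos_weight1.
exact/nonpos_weightN/nonpos_weight_q.
Qed.

(** The monomial $z^2q^m$ has weight $6-2m$, which drops to 0 at $m=3$. *)
Lemma nonpos_weight_den (m : nat) : (2 < m)%N -> nonpos_weight (gf_den m).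
Proof.
move=> m_gt2; apply: nonpos_weightM; apply: nonpos_weightX.
  exact: nonpos_weight_one_sub_q.
apply: nonpos_weightD; first exact: nonpos_weight1.
by apply/nonpos_weightN/nonpos_weight_monomial; lia.
Qed.

Lemma nonpos_weight_factor (m : nat) :
  (2 < m)%N -> nonpos_weight (gf_factor m).
Proof.
move=> m_gt2; apply: nonpos_weightM; first by apply: nonpos_weight_num; lia.
apply: nonpos_weightV; last exact: nonpos_weight_den.
by apply: gf_den_eqm1; lia.
Qed.

Lemma fpsCM (R : comUnitRingType) (a b : R) :
  fpsC (a * b) = fpsC a * fpsC b.
Proof.
by apply: fpsP => -[|n]; rewrite fps_coefCM //= mulr0.
Qed.

(** For $m=1$ the exponent [m./2] is 0, and for $m=2$ it is 1, so $1-z^2q^2=(1-zq)(1+zq)$ occurs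
    exactly once in the denominator and cancels. *)
Lemma gf_factor12 :
  (1 - fpsC 'X * fpsX _) * (gf_factor 1 * gf_factor 2) =
  gf_num 2 * (1 - fpsX _)^-1 * (1 - fpsX _ ^+ 2)^-1.
Proof.
have U1 := gf_den_unit (ltn0Sn 0); have U2 := gf_den_unit (ltn0Sn 1).
(* The numerator of index 2 takes no part in the cancellation and is kept opaque. *)
rewrite /gf_factor; move: (gf_num 2) => N2.
move: U1 U2; rewrite /gf_num /gf_den /= !expr1 !expr0 mulr1 => U1.
rewrite unitrM => /andP [U2 U3]; rewrite invrM //.
have -> : fpsC ('X ^+ 2) * fpsX {poly int} ^+ 2 = (fpsC 'X * fpsX _) ^+ 2.
  by rewrite expr2 fpsCM; ring.
move: U3; rewrite expr2 fpsCM -expr2 -exprMn.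
set x := fpsC 'X * _ => U3.
have eqx : (1 - x) * (1 + x) = 1 - x ^+ 2 by ring.
transitivity ((1 - x) * (1 + x) / (1 - x ^+ 2) *
    (N2 * (1 - fpsX _)^-1 * (1 - fpsX _ ^+ 2)^-1)); first by ring.
by rewrite eqx divrr // mul1r.
Qed.

Lemma nonpos_weight_partial_prod (N : nat) : (2 <= N)%N ->
  nonpos_weight ((1 - fpsC 'X * fpsX _) * \prod_(1 <= m < N.+1) gf_factor m).
Proof.
move=> N_ge2; rewrite big_ltn; last by lia.
rewrite big_ltn // (mulrA (gf_factor 1)) mulrA gf_factor12.
apply: nonpos_weightM; last first.
  rewrite big_nat; apply: nonpos_weight_prod => m /andP [m_gt2 _].
  exact: nonpos_weight_factor.
apply: nonpos_weightM; last first.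
  by apply: nonpos_weightV (nonpos_weight_one_sub_q 2); rewrite fps_coefB fps_coefXn subr0.
apply: nonpos_weightM; first exact: nonpos_weight_num.
by apply: nonpos_weightV (nonpos_weight_one_sub_q 1); rewrite fps_coefB subr0.
Qed.

Theorem theorem12 (F : nat -> {poly int})
    (hF : fps_infprod gf_factor (Fps F)) (n k : nat)
    (hk : (2 * n <= 3 * k)%N) :
  (F n.+1)`_k.+1 = (F n)`_k.
Proof.
have [N0 hN0] := hF n; have [N1 hN1] := hF n.+1.
(* At [N] both coefficients have stabilised, and both exceptional factors are present. *)
pose N := maxn 2 (maxn N0 N1).
have le2N : (2 <= N)%N by exact: leq_maxl.
have le0N : (N0 <= N)%N by lia.
have le1N : (N1 <= N)%N by lia.
(* Multiplying by $zq$ raises the weight by 1, turning the weak inequality into a strict one. *)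
have lt_nk : (2 * n.+1 < 3 * k.+1)%N by lia.
have <- : _ = F n := hN0 N le0N.
have <- : _ = F n.+1 := hN1 N le1N.
have := nonpos_weight_partial_prod N le2N n.+1 k.+1 lt_nk.
move: (\prod_(_ <= _ < _) _) => P.
(* The vanishing coefficient of $(1-zq)P$ is the difference of the two coefficients to be
   compared. *)
rewrite mulrBl mul1r -mulrA fps_coefB fps_coefCM coefB coefXM => /eqP.
rewrite subr_eq0 => /eqP -> /=; congr (_`_k).
(* Multiplication by $q$ shifts indices: only the term of index 1 survives. *)
rewrite big_ord_recl mul0r add0r big_ord_recl /= mul1r subSS subn0.
by rewrite big1 ?addr0 // => i _; rewrite mul0r.
Qed.
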